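(* Let $(E,\mathcal{B})$ be a measurable space and let $\tau$ be a two-valued $\sigma$-maxitive measure on $\mathcal{B}$. (i) $\tau$ is $\sigma$-principal if and only if there exists a $\sigma$-principal $\sigma$-additive measure $m : \mathcal{B} \to [0,\infty]$ such that $\tau = \delta_m$. (ii) $\tau$ is CCC if and only if there exists a CCC $\sigma$-additive measure $m : \mathcal{B} \to [0,\infty]$ such that $\tau = \delta_m$. Here $\delta_m(B) = 1$ if $m(B) > 0$ and $\delta_m(B) = 0$ otherwise, for $B \in \mathcal{B}$.
   Context: Let $(E,\mathcal{B})$ be a measurable space ($\mathcal{B}$ is a $\sigma$-algebra on the set $E$). A $\sigma$-maxitive measure on $\mathcal{B}$ is a map $\tau : \mathcal{B} \to [0,\infty]$ with $\tau(\emptyset) = 0$ and $\tau(\bigcup_{j \in \mathbb{N}} B_j) = \sup_{j \in \mathbb{N}} \tau(B_j)$ for every sequence $(B_j)_{j \in \mathbb{N}}$ of elements of $\mathcal{B}$ (not necessarily disjoint). It is two-valued if its set of values is $\tau(\mathcal{B}) = \{0,1\}$. A $\sigma$-additive measure on $\mathcal{B}$ is a measure in the usual sense, with values in $[0,\infty]$; it is not assumed finite or $\sigma$-finite. A two-valued $\sigma$-maxitive measure $\tau$ is said to be induced by a $\sigma$-additive measure $m$ if $\tau = \delta_m$. A $\sigma$-ideal of $\mathcal{B}$ is a nonempty subset $\mathcal{I} \subseteq \mathcal{B}$ that is closed under countable unions and such that $A \in \mathcal{B}$, $A \subseteq B$, $B \in \mathcal{I}$ imply $A \in \mathcal{I}$.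 A ($\sigma$-maxitive or $\sigma$-additive) measure $\mu$ on $\mathcal{B}$ is $\sigma$-principal if for each $\sigma$-ideal $\mathcal{I}$ of $\mathcal{B}$ there exists some $L \in \mathcal{I}$ such that $\mu(S \setminus L) = 0$ for all $S \in \mathcal{I}$. A ($\sigma$-maxitive or $\sigma$-additive) measure $\mu$ on $\mathcal{B}$ is CCC (satisfies the countable chain condition) if every family of pairwise disjoint elements of $\{B \in \mathcal{B} : \mu(B) > 0\}$ is countable (i.e. finite or countably infinite). *)

(* Defs.v *)
From HB Require Import structures.
From mathcomp Require Import all_boot all_order all_algebra.
From mathcomp Require Import all_classical all_reals all_analysis.

Set Implicit Arguments.
Unset Strict Implicit.
Unset Printing Implicit Defensive.

Import Order.TTheory GRing.Theory Num.Theory.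

Local Open Scope classical_set_scope.
Local Open Scope ereal_scope.

(* As for the library's measures, set functions are total on [set T], and only
   their values on measurable sets are relevant. *)

Definition sigma_maxitive_measure (R : realType) (d : measure_display)
    (T : measurableType d) (tau : set T -> \bar R) : Prop :=
  [/\ forall B, measurable B -> 0 <= tau B,
      tau set0 = 0
    & forall B : (set T)^nat, (forall j, measurable (B j)) ->
        tau (\bigcup_j B j) = ereal_sup (range (fun j => tau (B j)))].

Definition two_valued (R : realType) (d : measure_display)
    (T : measurableType d) (tau : set T -> \bar R) : Prop :=
  tau @` measurable = [set 0; 1].

Definition sigma_ideal (d : measure_display) (T : measurableType d)
    (I : set (set T)) : Prop :=
  [/\ I `<=` measurable,
      I !=set0,
      forall B : (set T)^nat, (forall j, I (B j)) -> I (\bigcup_j B j)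
    & forall A B, measurable A -> A `<=` B -> I B -> I A].

Definition sigma_principal (R : realType) (d : measure_display)
    (T : measurableType d) (mu : set T -> \bar R) : Prop :=
  forall I : set (set T), sigma_ideal I ->
    exists2 L, I L & forall S, I S -> mu (S `\` L) = 0.

(* Sets of positive measure are nonempty, so a pairwise disjoint family of them
   is injectively indexed and can be taken to be a set [F] of sets. *)
Definition CCC (R : realType) (d : measure_display)
    (T : measurableType d) (mu : set T -> \bar R) : Prop :=
  forall F : set (set T), F `<=` [set B | measurable B /\ 0 < mu B] ->
    trivIset F id -> countable F.

Definition delta (R : realType) (d : measure_display)
    (T : measurableType d) (m : set T -> \bar R) : set T -> \bar R :=
  fun B => if 0 < m B then 1 else 0.

Definition induced_by (R : realType) (d : measure_display)
    (T : measurableType d) (tau m : set T -> \bar R) : Prop :=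
  forall B, measurable B -> tau B = delta m B.

(* Main.v *)
Require Import Defs.
From HB Require Import structures.
From mathcomp Require Import all_boot all_order all_algebra.
From mathcomp Require Import all_classical all_reals all_analysis.

Import Order.TTheory.

Local Open Scope classical_set_scope.
Local Open Scope ring_scope.

(** A measure may take the value [+oo] freely, and on [{0, +oo}] addition and
    supremum coincide. Hence, for every sigma-maxitive [tau], the set function
    equal to [+oo] where [tau] is positive and to [0] elsewhere is a
    sigma-additive measure ([sigma_maxitive_infty_measure]), and it is positive
    exactly where [tau] is. A two-valued [tau] is determined by the sets on
    which it is positive, so this measure induces it.

    Being sigma-principal or CCC depends only on which measurable sets have
    positive measure ([sigma_principal_pos], [CCC_pos]). Both properties
    therefore pass from [tau] to the measure above, and from any measure
    inducing [tau] back to [tau]. *)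

Set Implicit Arguments.
Unset Strict Implicit.

Lemma sigma_principal_pos (R : realType) (d : measure_display)
    (T : measurableType d) (mu nu : set T -> \bar R) :
  (forall B, measurable B -> (0 <= nu B)%E) ->
  (forall B, measurable B -> (0 < mu B)%E = (0 < nu B)%E) ->
  sigma_principal mu -> sigma_principal nu.
Proof.
move=> nu0 pos_eq muP I idealI; have [Imeas _ _ _] := idealI.
have [L IL muL] := muP I idealI; exists L => // S IS.
have mSL : measurable (S `\` L) by apply: measurableD; exact: Imeas.
apply/eqP; rewrite eq_le nu0// andbT leNgt -pos_eq//.
by rewrite muL// ltxx.
Qed.

Lemma CCC_pos (R : realType) (d : measure_display)
    (T : measurableType d) (mu nu : set T -> \bar R) :
  (forall B, measurable B -> (0 < mu B)%E = (0 < nu B)%E) ->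
  CCC mu -> CCC nu.
Proof.
move=> pos_eq muC F Fpos; apply: muC => B /Fpos[mB nuB].
by split=> //; rewrite pos_eq.
Qed.

Definition infty_on_pos (R : realType) (X : Type) (tau : X -> \bar R) :
    X -> \bar R :=
  fun B => if (0 < tau B)%E then +oo%E else 0%E.

Lemma infty_on_pos_ge0 (R : realType) (X : Type) (tau : X -> \bar R) (B : X) :
  (0 <= infty_on_pos tau B)%E.
Proof. by rewrite /infty_on_pos; case: ifP. Qed.

Lemma infty_on_pos_gt0 (R : realType) (X : Type) (tau : X -> \bar R) (B : X) :
  (0 < infty_on_pos tau B)%E = (0 < tau B)%E.
Proof. by rewrite /infty_on_pos; case: ifP => _; rewrite ?ltry ?ltxx. Qed.

(** The series [\sum_j m (B j)] is [+oo] as soon as one term is, and [0]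
    otherwise; likewise a supremum of nonnegative numbers is positive exactly
    when one of them is. *)
Lemma infty_on_pos_semi_sigma_additive (R : realType) (d : measure_display)
    (T : measurableType d) (tau : set T -> \bar R) :
  sigma_maxitive_measure tau -> semi_sigma_additive (infty_on_pos tau).
Proof.
move=> [tau_ge0 _ tau_sup] B mB _ mUB.
have cvgB : cvgn (fun n => \sum_(0 <= i < n) infty_on_pos tau (B i))%E.
  by apply: is_cvg_nneseries => n _ _; exact: infty_on_pos_ge0.
suff -> : infty_on_pos tau (\bigcup_j B j) =
    (\sum_(0 <= i <oo) infty_on_pos tau (B i))%E by exact: cvgB.
have [[k tauBk]|noB] := pselect (exists k, (0 < tau (B k))%E).
  rewrite (nneseries_pinfty _ _ (k := k)) //.
  - rewrite /infty_on_pos tau_sup// ifT//; apply: lt_le_trans tauBk _.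
    by apply: ereal_sup_ubound; exists k.
  - by move=> n _; exact: infty_on_pos_ge0.
  - by rewrite /infty_on_pos tauBk.
have tauB j : (tau (B j) <= 0)%E.
  by rewrite leNgt; apply/negP => tauBj; apply: noB; exists j.
rewrite eseries0; last by move=> j _ _; rewrite /infty_on_pos ltNge tauB.
rewrite /infty_on_pos tau_sup// ltNge ifF//; apply/negbF.
by apply: ge_ereal_sup => _ [j _ <-]; exact: tauB.
Qed.

Lemma sigma_maxitive_infty_measure (R : realType) (d : measure_display)
    (T : measurableType d) (tau : set T -> \bar R) :
  sigma_maxitive_measure tau ->
  exists m : {measure set T -> \bar R}, m = infty_on_pos tau :> (set T -> \bar R).
Proof.
move=> tauM; have [_ tau0 _] := tauM.
have m0 : infty_on_pos tau set0 = 0%E by rewrite /infty_on_pos tau0 ltxx.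
pose mixin := isMeasure.Build d T R (infty_on_pos tau) m0
  (infty_on_pos_ge0 tau) (infty_on_pos_semi_sigma_additive tauM).
pose m : {measure set T -> \bar R} := HB.pack (infty_on_pos tau) mixin.
by exists m.
Qed.

Lemma two_valued_delta (R : realType) (d : measure_display)
    (T : measurableType d) (tau m : set T -> \bar R) :
  two_valued tau ->
  (forall B, measurable B -> (0 < m B)%E = (0 < tau B)%E) ->
  induced_by tau m.
Proof.
move=> tau01 pos_eq B mB; rewrite /delta pos_eq//.
have : [set 0%E; 1%E] (tau B) by rewrite -tau01; exists B.
by case=> ->; rewrite ?ltxx ?lte01.
Qed.

Lemma induced_by_pos (R : realType) (d : measure_display)
    (T : measurableType d) (tau m : set T -> \bar R) :
  induced_by tau m ->
  forall B, measurable B -> (0 < m B)%E = (0 < tau B)%E.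
Proof.
move=> ind B mB; rewrite ind// /delta.
by case: ifP => _; rewrite ?ltxx ?lte01.
Qed.

Unset Implicit Arguments.
Set Strict Implicit.

Theorem corollary2p2 (R : realType) (d : measure_display)
    (T : measurableType d) (tau : set T -> \bar R)
    (tau_maxitive : sigma_maxitive_measure tau)
    (tau_two_valued : two_valued tau) :
  (sigma_principal tau <->
     exists m : {measure set T -> \bar R},
       sigma_principal m /\ induced_by tau m) /\
  (CCC tau <->
     exists m : {measure set T -> \bar R},
       CCC m /\ induced_by tau m).
Proof.
have [tau_ge0 _ _] := tau_maxitive.
have [m mE] := sigma_maxitive_infty_measure tau_maxitive.
have m_pos B : measurable B -> (0 < m B)%E = (0 < tau B)%E.
  by move=> _; rewrite mE infty_on_pos_gt0.
have tau_m : induced_by tau m by exact: two_valued_delta.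
split; split.
- move=> tauP; exists m; split=> //.
  by apply: sigma_principal_pos tauP => // B mB; rewrite m_pos.
- move=> [m' [m'P /induced_by_pos m'_pos]].
  exact: sigma_principal_pos m'P.
- move=> tauC; exists m; split=> //.
  by apply: CCC_pos tauC => B mB; rewrite m_pos.
- move=> [m' [m'C /induced_by_pos m'_pos]].
  exact: CCC_pos m'C.
Qed.
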